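(* Let $V$ be a simple $\mathcal{R}$-module. If there exists a nonzero vector $v\in V$ such that $\mathcal{R}_+v=0$, then $V$ is a highest weight $\mathcal{R}$-module.
   Context: The Ramond algebra $\mathcal{R}=\mathcal{R}_{\bar 0}\oplus\mathcal{R}_{\bar 1}$ is the Lie superalgebra with basis $\{L_m,G_m,c\mid m\in\mathbb{Z}\}$, where $\mathcal{R}_{\bar 0}=\mathrm{span}\{L_m,c\}$, $\mathcal{R}_{\bar 1}=\mathrm{span}\{G_m\}$, and brackets $[L_m,L_n]=(m-n)L_{m+n}+\delta_{m+n,0}\frac{m^3-m}{12}c$, $[L_m,G_n]=(\frac m2-n)G_{m+n}$, $[G_m,G_n]=2L_{m+n}+\frac13\delta_{m+n,0}(m^2-\frac14)c$, $[\mathcal{R},c]=0$. $\mathcal{R}_+=\mathrm{span}\{L_m,G_m\mid m\in\mathbb{Z}_+\}$. Modules are $\mathbb{Z}_2$-graded (super)modules. A highest weight $\mathcal{R}$-module is a module generated by a nonzero vector $w$ with $\mathcal{R}_+w=0$, $L_0w=\lambda w$ and $cw=l w$ for some $\lambda,l\in\mathbb{C}$. *)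

(* Defs.v *)
From mathcomp Require Import all_boot all_order all_algebra.
From mathcomp Require Import reals.
From mathcomp.real_closed Require Import complex.
Set Implicit Arguments. Unset Strict Implicit. Unset Printing Implicit Defensive.
Import GRing.Theory Num.Theory.
Local Open Scope ring_scope.

Section Ramond.
Variables (R : realType) (V : lmodType R[i]).

Definition lin_op (f : V -> V) : Prop :=
  forall (a : R[i]) (u v : V), f (a *: u + v) = a *: f u + f v.

Definition subspace (W : V -> Prop) : Prop :=
  W 0 /\ (forall (a : R[i]) u v, W u -> W v -> W (a *: u + v)).

Definition is_grading (V0 V1 : V -> Prop) : Prop :=
  [/\ subspace V0, subspace V1,
      (forall v, V0 v -> V1 v -> v = 0) &
      (forall v, exists v0 v1, [/\ V0 v0, V1 v1 & v = v0 + v1])].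

Definition kdelta (m n : int) (x : R[i]) : R[i] := if m + n == 0 then x else 0.

(* (V0 (+) V1, L, G, c) is a (super)module over the Ramond algebra:
   L_m, c even, G_m odd, and the super-brackets act as
   [L_m,L_n] = L_m L_n - L_n L_m, [L_m,G_n] = L_m G_n - G_n L_m,
   [G_m,G_n] = G_m G_n + G_n G_m, [R,c]=0. *)
Definition ramond_module (V0 V1 : V -> Prop) (L G : int -> V -> V) (c : V -> V)
  : Prop :=
  is_grading V0 V1 /\
  ((forall m, lin_op (L m)) /\ (forall m, lin_op (G m)) /\ lin_op c) /\
  (forall m v, (V0 v -> V0 (L m v)) /\ (V1 v -> V1 (L m v))) /\
  (forall m v, (V0 v -> V1 (G m v)) /\ (V1 v -> V0 (G m v))) /\
  (forall v, (V0 v -> V0 (c v)) /\ (V1 v -> V1 (c v))) /\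
      (forall m n v, L m (L n v) - L n (L m v) =
          (m - n)%:~R *: L (m + n) v
          + kdelta m n (((m ^+ 3 - m)%:~R) / 12%:R) *: c v) /\
      (forall m n v, L m (G n v) - G n (L m v) =
          ((m%:~R) / 2%:R - n%:~R) *: G (m + n) v) /\
      (forall m n v, G m (G n v) + G n (G m v) =
          2%:R *: L (m + n) v
          + kdelta m n (3%:R^-1 * ((m ^+ 2)%:~R - 4%:R^-1)) *: c v) /\
  (forall m v, L m (c v) = c (L m v) /\ G m (c v) = c (G m v)).

Definition stable (L G : int -> V -> V) (c : V -> V) (W : V -> Prop) : Prop :=
  (forall m v, W v -> W (L m v)) /\ (forall m v, W v -> W (G m v)) /\
  (forall v, W v -> W (c v)).

Definition graded_submodule (V0 V1 : V -> Prop) (L G : int -> V -> V)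
  (c : V -> V) (W : V -> Prop) : Prop :=
  [/\ subspace W, stable L G c W &
      forall w, W w -> exists w0 w1, [/\ W w0, V0 w0, W w1, V1 w1 & w = w0 + w1]].

Definition simple_module (V0 V1 : V -> Prop) (L G : int -> V -> V)
  (c : V -> V) : Prop :=
  (exists v : V, v != 0) /\
  forall W, graded_submodule V0 V1 L G c W ->
    (forall w, W w -> w = 0) \/ (forall v, W v).

(* R_+ w = 0, where R_+ = span{L_m, G_m | m in Z_+}, Z_+ = {1,2,...} *)
Definition Rplus_ann (L G : int -> V -> V) (w : V) : Prop :=
  forall m : int, 0 < m -> L m w = 0 /\ G m w = 0.

Definition generated_by (L G : int -> V -> V) (c : V -> V) (w : V) : Prop :=
  forall W, subspace W -> stable L G c W -> W w -> forall v, W v.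

Definition highest_weight_module (L G : int -> V -> V) (c : V -> V) : Prop :=
  exists w : V, [/\ w != 0, generated_by L G c w, Rplus_ann L G w &
    exists lam l : R[i], L 0 w = lam *: w /\ c w = l *: w].

End Ramond.

(* Main.v *)
Require Import Defs.
From mathcomp Require Import all_boot all_order all_algebra.
From mathcomp Require Import boolp classical_sets reals.
From mathcomp.real_closed Require Import complex.
From mathcomp Require Import zify ring lra.
Set Implicit Arguments. Unset Strict Implicit. Unset Printing Implicit Defensive.
Import Order.TTheory GRing.Theory Num.Theory.
Local Open Scope ring_scope.

(* The singular vector [v] may be taken homogeneous, so it generates [V], which
   then has countable dimension; as the field is uncountable, the central [c]
   is a scalar. On the singular vectors [C[G_0] v] one has
   [L_0 = G_0^2 + c/24], so an eigenvector of [G_0] there is (up to taking a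
   homogeneous component) a highest weight vector. If there is none, [C[G_0] v]
   is torsion free, and then a generic irreducibility argument applies: in the
   span [V_N] of the [u p(G_0) v], with [u] a product of lowering modes of total
   weight [N > 0], no nonzero vector is killed by all products of raising modes
   of weight [N], because the leading terms in [G_0] of the pairing between
   raising and lowering words are triangular. Hence the sum of the [V_N] is
   direct. But [G_0 v] also generates [V], so
   [v] lies in [G_0 C[G_0] v + sum_{N > 0} V_N], hence [v = p(G_0) G_0 v] for
   some [p], contradicting torsion freeness. *)

(** * Linear operators and polynomials in one operator *)

Section LinOp.
Context (R : realType) (V : lmodType R[i]) (f : V -> V).
Hypothesis fl : lin_op f.

Lemma lin_opD u v : f (u + v) = f u + f v.
Proof. by rewrite -[u in LHS]scale1r fl scale1r. Qed.

Lemma lin_op0 : f 0 = 0.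
Proof. by apply: (@addrI _ (f 0)); rewrite -lin_opD !addr0. Qed.

Lemma lin_opZ a u : f (a *: u) = a *: f u.
Proof. by rewrite -[a *: u]addr0 fl lin_op0 addr0. Qed.

Lemma lin_opN u : f (- u) = - f u.
Proof. by rewrite -scaleN1r lin_opZ scaleN1r. Qed.

Lemma lin_opB u v : f (u - v) = f u - f v.
Proof. by rewrite lin_opD lin_opN. Qed.

Lemma lin_op_sum (I : Type) (s : seq I) (E : I -> V) :
  f (\sum_(i <- s) E i) = \sum_(i <- s) f (E i).
Proof.
by elim: s => [|i s IH]; rewrite ?big_nil ?lin_op0 // !big_cons lin_opD IH.
Qed.

Lemma lin_op_iter k : lin_op (iter k f).
Proof. by elim: k => [|k IH] a u v //=; rewrite IH fl. Qed.

Definition poly_op (p : {poly R[i]}) (x : V) : V :=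
  \sum_(i < size p) p`_i *: iter i f x.

Lemma poly_op_wide n (p : {poly R[i]}) x :
  (size p <= n)%N -> poly_op p x = \sum_(i < n) p`_i *: iter i f x.
Proof.
move=> le; rewrite /poly_op (big_ord_widen _ (fun i => p`_i *: iter i f x) le).
rewrite big_mkcond; apply: eq_bigr => i _.
by case: ltnP => // h; rewrite nth_default // scale0r.
Qed.

Lemma poly_opD a p q x : poly_op (a *: p + q) x = a *: poly_op p x + poly_op q x.
Proof.
set n := maxn (size p) (size q).
have hp : (size p <= n)%N by rewrite leq_maxl.
have hq : (size q <= n)%N by rewrite leq_maxr.
rewrite (@poly_op_wide n p) // (@poly_op_wide n q) // (@poly_op_wide n).
  rewrite scaler_sumr -big_split; apply: eq_bigr => i _ /=.
  by rewrite coefD coefZ scalerDl scalerA.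
by rewrite (leq_trans (size_polyD _ _)) // geq_max (leq_trans (size_scale_leq _ _)).
Qed.

Lemma poly_op0 x : poly_op 0 x = 0.
Proof. by rewrite /poly_op size_poly0 big_ord0. Qed.

Lemma poly_op_sum (I : Type) (s : seq I) (b : I -> R[i]) (q : I -> {poly R[i]}) x :
  poly_op (\sum_(i <- s) b i *: q i) x = \sum_(i <- s) b i *: poly_op (q i) x.
Proof.
by elim: s => [|i s IH]; rewrite ?big_nil ?poly_op0 // !big_cons poly_opD IH.
Qed.

Lemma lin_poly_op p : lin_op (poly_op p).
Proof.
move=> a u v; rewrite /poly_op scaler_sumr -big_split; apply: eq_bigr => i _ /=.
by rewrite lin_op_iter scalerDr !scalerA mulrC.
Qed.

Lemma poly_opMX p x : poly_op (p * 'X) x = f (poly_op p x).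
Proof.
rewrite (@poly_op_wide (size p).+1) ?big_ord_recl /=; last first.
  have [->|p0] := eqVneq p 0; first by rewrite mul0r size_poly0.
  by rewrite size_mulX.
rewrite coefMX /= scale0r add0r lin_op_sum.
by apply: eq_bigr => i _; rewrite coefMX /= lin_opZ.
Qed.

Lemma poly_op_comm p x : poly_op p (f x) = f (poly_op p x).
Proof.
rewrite /poly_op lin_op_sum; apply: eq_bigr => i _.
by rewrite -iterSr lin_opZ.
Qed.

Lemma poly_opMXsubC p a x : poly_op (p * ('X - a%:P)) x = f (poly_op p x) - a *: poly_op p x.
Proof.
rewrite mulrBr [p * a%:P]mulrC mul_polyC addrC -scaleNr poly_opD poly_opMX.
by rewrite scaleNr addrC.
Qed.

Lemma poly_op_Xn k x : poly_op 'X^k x = iter k f x.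
Proof.
elim: k => [|k IH]; last by rewrite exprSr poly_opMX IH.
by rewrite expr0 /poly_op size_poly1 big_ord1 coefC scale1r.
Qed.

(** The field is algebraically closed, so write [p = q * ('X - r)]: either [q] already kills [x] and
    has smaller size, or [poly_op q x] is an eigenvector with eigenvalue [r]. *)
Lemma poly_op_eigenvector p x : p != 0 -> x != 0 -> poly_op p x = 0 ->
  exists q r, poly_op q x != 0 /\ f (poly_op q x) = r *: poly_op q x.
Proof.
move=> + x0; have [n] := ubnP (size p); elim: n p => // n IH p sp p0 px.
have sp1 : size p != 1%N.
  apply: contra_neq x0 => E; move: px.
  rewrite (@poly_op_wide 1) ?E // big_ord1 /= => /(congr1 ( *:%R (p`_0)^-1)).
  rewrite scalerA mulVf ?scale1r ?scaler0 //.
  by apply: contra_neq p0 => e; rewrite (size1_polyC (eq_leq E)) e.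
have [r /factor_theorem [q qE]] := closed_rootP p sp1.
have q0 : q != 0 by apply: contra_neq p0 => e; rewrite qE e mul0r.
have [qx|qx] := eqVneq (poly_op q x) 0.
  apply: (IH q) => //; move: sp; rewrite qE size_Mmonic ?monicXsubC // size_XsubC.
  by rewrite addn2.
by exists q, r; split=> //; apply/eqP; rewrite -subr_eq0 -poly_opMXsubC -qE px.
Qed.

End LinOp.

(** * Super-commutation relations when the centre acts by the scalar [l] *)

Section Filtration.
Context (R : realType) (V : lmodType R[i]) (L G : int -> V -> V) (l : R[i]).
Hypothesis linL : forall m, lin_op (L m).
Hypothesis linG : forall m, lin_op (G m).
Hypothesis LL : forall m n v, L m (L n v) - L n (L m v) =
  (m - n)%:~R *: L (m + n) v
  + kdelta m n (((m ^+ 3 - m)%:~R) / 12%:R) *: (l *: v).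
Hypothesis LG : forall m n v, L m (G n v) - G n (L m v) =
  ((m%:~R) / 2%:R - n%:~R) *: G (m + n) v.
Hypothesis GG : forall m n v, G m (G n v) + G n (G m v) =
  2%:R *: L (m + n) v
  + kdelta m n (3%:R^-1 * ((m ^+ 2)%:~R - 4%:R^-1)) *: (l *: v).

Definition mode (t : bool) (m : int) : V -> V := if t then L m else G m.
Arguments mode : simpl never.

Lemma lin_mode t m : lin_op (mode t m).
Proof. by case: t. Qed.

Definition bsign (t u : bool) : R[i] := if t || u then 1 else -1.

Definition bcoef (t u : bool) (m n : int) : R[i] :=
  match t, u with
  | true, true => (m - n)%:~R
  | true, false => m%:~R / 2%:R - n%:~R
  | false, true => m%:~R - n%:~R / 2%:R
  | false, false => 2%:R
  end.

Definition bcentral (t u : bool) (m n : int) : R[i] :=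
  match t, u with
  | true, true => kdelta m n (((m ^+ 3 - m)%:~R) / 12%:R) * l
  | false, false => kdelta m n (3%:R^-1 * ((m ^+ 2)%:~R - 4%:R^-1)) * l
  | _, _ => 0
  end.

(** Uniform form of the super-brackets: [true] marks the even modes [L] and [false] the odd modes
    [G], so a bracket has type [t == u]. *)
Lemma mode_comm t u m n v :
  mode t m (mode u n v) = bsign t u *: mode u n (mode t m v)
    + bcoef t u m n *: mode (t == u) (m + n) v + bcentral t u m n *: v.
Proof.
case: t; case: u; rewrite /= /bsign /= ?scale1r ?scale0r ?addr0 -?scalerA.
- by rewrite -addrA -LL addrC subrK.
- by rewrite -LG addrC subrK.
- have -> : m%:~R - n%:~R / 2%:R = - (n%:~R / 2%:R - m%:~R) :> R[i].
    by rewrite opprB.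
  by rewrite scaleNr addrC (addrC m) -LG opprB subrK.
- by rewrite scaleN1r -addrA -GG addrCA addrA subrK.
Qed.

Lemma bcentral_eq0 t u m n : m + n != 0 -> bcentral t u m n = 0.
Proof. by case: t; case: u; rewrite //= /kdelta => /negPf ->; rewrite mul0r. Qed.

(** The bracket [[G_0, G_0] = 2 L_0 - l / 12] divided by 2. *)
Lemma G0_sqr v : L 0 v = G 0 (G 0 v) + (l / 24%:R) *: v.
Proof.
have := GG 0 0 v; rewrite /kdelta addr0 eqxx expr0n /= sub0r scalerA -mulr2n -scaler_nat => E.
have n2 : (2%:R : R[i]) != 0 by rewrite pnatr_eq0.
apply: (scalerI n2); rewrite scalerDr E -addrA scalerA.
rewrite -scalerDl.
suff -> : 3%:R^-1 * - 4%:R^-1 * l + 2%:R * (l / 24%:R) = 0.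
  by rewrite scale0r addr0.
by field.
Qed.

(** * The singular vectors [G_0^k v] *)

Variable v : V.
Hypothesis sing_v : Rplus_ann L G v.

Definition G0_pow (k : nat) : V := iter k (G 0) v.

(** For [m > 0] the brackets of [L_m] and [G_m] with [G_0] are multiples of [G_m] and [L_m], without
    central term. *)
Lemma sing_G0_pow k : Rplus_ann L G (G0_pow k).
Proof.
elim: k => [|k IH] //= m m0; have [Lm Gm] := IH m m0.
have m0' : m + 0 != 0 by rewrite addr0 gt_eqF.
split.
  by have := LG m 0 (G0_pow k); rewrite Lm addr0 Gm (lin_op0 (linG _)) subr0 scaler0.
have := GG m 0 (G0_pow k); rewrite /kdelta (negPf m0') addr0 Lm Gm scaler0.
by rewrite (lin_op0 (linG _)) addr0 scale0r addr0.
Qed.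

Lemma mode_G0_pow t m k : 0 < m -> mode t m (G0_pow k) = 0.
Proof. by move=> /(sing_G0_pow k) []; case: t. Qed.

Definition peval (p : {poly R[i]}) : V := poly_op (G 0) p v.

Lemma pevalD a p q : peval (a *: p + q) = a *: peval p + peval q.
Proof. exact: poly_opD. Qed.

Lemma peval0 : peval 0 = 0.
Proof. exact: poly_op0. Qed.

Lemma pevalMX p : peval (p * 'X) = G 0 (peval p).
Proof. exact: poly_opMX. Qed.

Lemma peval_Xn k : peval 'X^k = G0_pow k.
Proof. exact: poly_op_Xn. Qed.

(* A letter [n > 1] stands for [L_{-n/2}] if [n] is odd and for [G_{-n/2}] if
   [n] is even, so that the order of [nat] refines that of the modes.
   [filt N d] is spanned by the [y_1 .. y_s G_0^k v] of total weight [N] with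
   [2 s + k < d]. The degrees ([G_0]: 1; [L_0] and all letters: 2; raising
   modes: 0) are chosen so that the multiples [[L_m, G_{-m}]] and
   [[G_m, L_{-m}]] of [G_0] lower the degree, while [[L_m, L_{-m}]] and
   [[G_m, G_{-m}]], which involve [L_0], preserve it. *)
Inductive filt : int -> nat -> V -> Prop :=
| filt_0 N d : filt N d 0
| filt_comb N d a x y : filt N d x -> filt N d y -> filt N d (a *: x + y)
| filt_base d (p : {poly R[i]}) : (size p <= d)%N -> filt 0 d (peval p)
| filt_step N M d e n x : (1 < n)%N -> M = N + (n./2)%:Z -> (d.+2 <= e)%N ->
    filt N d x -> filt M e (mode (odd n) (- (n./2)%:Z) x).

(** * Effect of the modes on weight and degree *)

Lemma filt_mon N d e x : (d <= e)%N -> filt N d x -> filt N e x.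
Proof.
move=> le H; elim: H e le => {N d x} [N d|N d a x y _ IHx _ IHy|d p h|N M d d' n x n1 EM h H _] e le.
- exact: filt_0.
- by apply: filt_comb; auto.
- by apply: filt_base; apply: leq_trans le.
- by apply: (filt_step n1 EM _ H); apply: leq_trans le.
Qed.

Lemma filtD N d x y : filt N d x -> filt N d y -> filt N d (x + y).
Proof. by move=> hx; rewrite -[x]scale1r; apply: filt_comb. Qed.

Lemma filtZ N d a x : filt N d x -> filt N d (a *: x).
Proof. by move=> hx; rewrite -[_ *: _]addr0; apply: filt_comb => //; apply: filt_0. Qed.

Lemma filtB N d x y : filt N d x -> filt N d y -> filt N d (x - y).
Proof. by move=> hx hy; rewrite -scaleN1r; apply: filtD => //; apply: filtZ. Qed.

Lemma filt_sum N d (I : eqType) (s : seq I) (E : I -> V) :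
  (forall i, i \in s -> filt N d (E i)) -> filt N d (\sum_(i <- s) E i).
Proof.
by move=> H; rewrite big_seq; apply: big_ind => //; [apply: filt_0 | apply: filtD].
Qed.

Lemma filt_lt0 N d x : filt N d x -> N < 0 -> x = 0.
Proof.
elim=> {N d x} // [N d a x y _ IHx _ IHy N0|N M d e n x n1 -> _ _ IH N0].
  by rewrite IHx ?IHy // scaler0 addr0.
by rewrite IH ?(lin_op0 (lin_mode _ _)) //; lia.
Qed.

(** Every letter has positive weight, so a lowering step that ends in weight 0 starts from negative
    weight, where only 0 lives. *)
Lemma filt_wt0 N d x : filt N d x -> N = 0 -> exists2 p : {poly R[i]}, (size p <= d)%N & x = peval p.
Proof.
elim=> {N d x} [N d _|N d a x y _ IHx _ IHy N0|d p h _|N M d e n x n1 -> _ H _ N0].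
- by exists 0; rewrite ?size_poly0 ?peval0.
- have [p hp ->] := IHx N0; have [q hq ->] := IHy N0.
  exists (a *: p + q); rewrite ?pevalD //.
  by rewrite (leq_trans (size_polyD _ _)) // geq_max (leq_trans (size_scale_leq _ _)).
- by exists p.
- exists 0; rewrite ?size_poly0 // peval0 (@filt_lt0 N d x) ?(lin_op0 (lin_mode _ _)) //.
  by lia.
Qed.

Lemma filt_deg0 N x : filt N 0 x -> x = 0.
Proof.
move E: 0%N => d H; elim: H E => {N d x} // [N d a x y _ IHx _ IHy E|d p h E|N M d e n x _ _ le _ _ E].
- by rewrite IHx ?IHy // scaler0 addr0.
by move: h; rewrite -E leqn0 size_poly_eq0 => /eqP ->; rewrite peval0.
- by move: le; rewrite -E.
Qed.

Lemma filt_mode_neg {N M d e t m x} : 0 < m -> M = N + m -> (d.+2 <= e)%N ->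
  filt N d x -> filt M e (mode t (- m) x).
Proof.
case: m => // m m0 EM le H.
have Eo : odd (t + m.*2) = t by rewrite oddD odd_double addbF; case: (t).
have Eh : (t + m.*2)./2 = m by rewrite halfD doubleK odd_double andbF add0n; case: (t).
have := @filt_step N M d e (t + m.*2) x; rewrite Eo Eh; apply=> //; lia.
Qed.

(** When [G_0] passes a letter, the bracket puts a letter of the same weight in its place; a degree
    is gained only when [G_0] reaches [p(G_0) v]. *)
Lemma filt_G0 N d x : filt N d x -> filt N d.+1 (G 0 x).
Proof.
elim=> {N d x} [N d|N d a x y _ IHx _ IHy|d p h|N M d e n x n1 -> le H IH].
- by rewrite (lin_op0 (linG 0)); apply: filt_0.
- by rewrite linG; apply: filt_comb.
- rewrite -pevalMX; apply: filt_base.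
  have [->|p0] := eqVneq p 0; first by rewrite mul0r size_poly0.
  by rewrite size_mulX.
- rewrite -[G 0 _]/(mode false 0 _) mode_comm bcentral_eq0; last by lia.
  rewrite scale0r addr0 add0r; apply: filtD; apply: filtZ.
    by apply: (filt_mode_neg _ _ _ IH); lia.
  by apply: (filt_mode_neg _ _ _ H); lia.
Qed.

Lemma filt_L0 N d x : filt N d x -> filt N d.+2 (L 0 x).
Proof.
move=> H; rewrite G0_sqr; apply: filtD; first by do 2!apply: filt_G0.
by apply: filtZ; apply: filt_mon H; lia.
Qed.

Lemma filt_mode0 t N d x : filt N d x -> filt N d.+2 (mode t 0 x).
Proof. by case: t => [/filt_L0//|/filt_G0]; apply: filt_mon. Qed.

(** A raising mode that passes a letter either leaves it in place or replaces it by their bracket, a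
    mode of degree at most 2 whatever the sign of its index. At the end it kills [G_0^k v]. *)
Lemma filt_pos {t m N M d x} : 0 < m -> M = N - m -> filt N d x -> filt M d (mode t m x).
Proof.
move=> + + H.
elim: H t m M => {N d x} [N d|N d a x y _ IHx _ IHy|d p h|N M d e n x n1 -> le H IH] t m M' m0 ->.
- by rewrite (lin_op0 (lin_mode _ _)); apply: filt_0.
- by rewrite lin_mode; apply: filt_comb; auto.
- rewrite /peval (lin_op_sum (lin_mode _ _)) big1 => [|i _]; first exact: filt_0.
  by rewrite (lin_opZ (lin_mode _ _)) mode_G0_pow // scaler0.
- rewrite mode_comm; apply: filtD; [apply: filtD; apply: filtZ|].
  + by apply: (filt_mode_neg _ _ le (IH t m _ m0 erefl)); lia.
  + apply: (filt_mon le).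
    have [lt|lt|E] := ltgtP m (n./2)%:Z.
    * have -> : m - (n./2)%:Z = - ((n./2)%:Z - m) by lia.
      by apply: (filt_mode_neg _ _ _ H); lia.
    * apply: (@filt_mon _ d); first by lia.
      by apply: IH; lia.
    * have -> : m - (n./2)%:Z = 0 by lia.
      have -> : N + (n./2)%:Z - m = N by lia.
      exact: filt_mode0.
  + have [E|E] := eqVneq (m - (n./2)%:Z) 0.
      have -> : N + (n./2)%:Z - m = N by lia.
      by apply: filtZ; apply: filt_mon H; lia.
    by rewrite bcentral_eq0 // scale0r; apply: filt_0.
Qed.

Lemma filt_mode {t m N M d x} : M = N - m -> filt N d x -> filt M d.+2 (mode t m x).
Proof.
have [lt|lt|->] := ltgtP m 0 => EM H.
- by rewrite -[m]opprK; apply: (filt_mode_neg _ _ _ H); lia.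
- by apply: (@filt_mon _ d); [lia | apply: filt_pos H].
- by rewrite EM subr0; apply: filt_mode0.
Qed.

(** * Words of lowering and raising modes *)

Notation raise n := (mode (odd n) (n./2)%:Z).
Notation lower n := (mode (odd n) (- (n./2)%:Z)).

Definition act (w : seq nat) (x : V) : V := foldr (fun n y => lower n y) x w.
(** The head of [w] acts first here but last in [act], so in [pact w (act w x)] the raising mode of
    the head meets its own lowering mode first. *)
Definition pact (w : seq nat) (x : V) : V := foldl (fun y n => raise n y) x w.
Definition weight (w : seq nat) : nat := sumn [seq n./2 | n <- w].
Definition letters (w : seq nat) : bool := all (fun n => 1 < n)%N w.

Lemma lin_act w : lin_op (act w).
Proof. by elim: w => [|n w IH] a x y //=; rewrite IH lin_mode. Qed.

Lemma lin_pact w : lin_op (pact w).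
Proof.
by rewrite /pact; elim: w => [|n w IH] a x y //=; rewrite lin_mode IH.
Qed.

Lemma filt_act w N d e x : letters w -> (d + (size w).*2 <= e)%N ->
  filt N d x -> filt (N + (weight w)%:Z) e (act w x).
Proof.
elim: w e => [|n w IH] e /=; first by rewrite !addr0 addn0 => _ le; apply: filt_mon.
move=> /andP[n1 lw] le H; rewrite /weight /= -/(weight w).
apply: (filt_mode_neg _ _ _ (IH _ lw (leqnn _) H)); last by lia.
- by lia.
- by lia.
Qed.

Lemma filt_word w e k : letters w -> ((size w).*2 + k < e)%N ->
  filt (weight w)%:Z e (act w (G0_pow k)).
Proof.
move=> lw le; rewrite -[(weight w)%:Z]add0r; apply: (@filt_act w 0 k.+1) => //.
  by lia.
by rewrite -peval_Xn; apply: filt_base; rewrite size_polyXn.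
Qed.

Lemma filt_pact w N M d x : letters w -> M = N - (weight w)%:Z ->
  filt N d x -> filt M d (pact w x).
Proof.
elim: w N x => [|n w IH] N x /=; first by rewrite /weight /= subr0 => _ ->.
move=> /andP[n1 lw] EM H; apply: (IH (N - (n./2)%:Z)) => //.
  by rewrite EM /weight /= -/(weight w); lia.
by apply: filt_pos H; lia.
Qed.

(** * Leading terms of the pairing between raising and lowering words *)

Lemma L0_act w x : letters w ->
  L 0 (act w x) = act w (L 0 x) + (weight w)%:R *: act w x.
Proof.
elim: w => [|n w IH] /=; first by rewrite scale0r addr0.
move=> /andP[n1 lw]; rewrite -[L 0 _]/(mode true 0 _) mode_comm /mode -/(mode _ _) IH //.
rewrite bcentral_eq0; last by lia.
rewrite /bsign /= scale1r scale0r addr0 lin_opD ?(lin_opZ (lin_mode _ _)); last exact: lin_mode.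
rewrite -addrA; congr (_ + _); rewrite add0r /weight /= -/(weight w) natrD addrC scalerDl.
congr (_ + _); rewrite /bcoef; case: (odd n); rewrite ?mul0r ?sub0r ?rmorphN /= ?opprK //.
Qed.

(** Besides [G_0^2], the operator [L_0] contributes only the scalars [weight w] and [l / 24], which
    do not raise the degree. *)
Lemma L0_lead w k : letters w ->
  filt (weight w)%:Z ((size w).*2 + k.+2) (L 0 (act w (G0_pow k)) - act w (G0_pow k.+2)).
Proof.
move=> lw; rewrite L0_act // G0_sqr (lin_opD (lin_act _)) (lin_opZ (lin_act _)).
rewrite addrAC addrAC addrC !addrA addNr add0r -scalerDl.
by apply: filtZ; apply: filt_word => //; lia.
Qed.

(** The degree drops strictly since no bracket is [L_0]: with a smaller letter it is a raising mode
    or, when the halves agree, the multiple [[L_m, G_{-m}]] of [G_0]. *)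
Lemma raise_lt p w k : (1 < p)%N -> all (fun n => 1 < n < p)%N w ->
  filt ((weight w)%:Z - (p./2)%:Z) ((size w).*2 + k) (raise p (act w (G0_pow k))).
Proof.
move=> p1; elim: w => [|n w IH] /=; first by move=> _; rewrite mode_G0_pow; [apply: filt_0 | lia].
move=> /andP[/andP[n1 np] lw]; have lw' : letters w.
  by apply: sub_all lw => i /andP[].
rewrite /weight /= -/(weight w) mode_comm.
have E : (p./2)%:Z + - (n./2)%:Z = 0 -> odd p && ~~ odd n.
  by move=> h; have := odd_double_half p; have := odd_double_half n;
     case: (odd p); case: (odd n) => /=; lia.
apply: filtD; [apply: filtD; apply: filtZ|].
- by apply: (filt_mode_neg _ _ _ (IH lw)); lia.
- have [h|h] := ltnP n./2 p./2.
    by apply: (@filt_pos _ _ (weight w)%:Z); [by lia | by lia | apply: filt_word => //; lia].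
  have h' : n./2 = p./2 by have := half_leq (ltnW np); lia.
  have e0 : (p./2)%:Z + - (n./2)%:Z = 0 by lia.
  have /andP[-> /negPf ->] := E e0; rewrite e0 /=.
  apply: (@filt_mon _ ((size w).*2 + k).+2); first by lia.
  have -> : (n./2 + weight w)%:Z - (p./2)%:Z = (weight w)%:Z by lia.
  by apply: filt_G0; apply: filt_word => //; lia.
- have [e0|e0] := eqVneq ((p./2)%:Z + - (n./2)%:Z) 0; last first.
    by rewrite bcentral_eq0 // scale0r; apply: filt_0.
  have /andP[-> /negPf ->] := E e0.
  by rewrite scale0r; apply: filt_0.
Qed.

(* The letters of an admissible word are nonincreasing, and the fermionic (even)
   ones are not repeated since [G_{-m}^2 = L_{-2m}]. *)
Definition adm (a b : nat) : bool := if odd a then (b <= a)%N else (b < a)%N.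

Lemma adm_trans : transitive adm.
Proof. by move=> b a c; rewrite /adm; case: (odd a); case: (odd b); lia. Qed.

Lemma adm_path_lt p w : letters w -> ~~ odd p -> path adm p w ->
  all (fun n => 1 < n < p)%N w.
Proof.
move=> lw pe; rewrite (path_sortedE adm_trans) => /andP[aw _].
apply/allP => n nw; rewrite (allP lw) //=.
by have := allP aw n nw; rewrite /adm (negPf pe).
Qed.

Lemma lower_raise_lt p w k : (1 < p)%N -> all (fun n => 1 < n < p)%N w ->
  filt (weight w)%:Z ((size w).*2 + k.+2) (lower p (raise p (act w (G0_pow k)))).
Proof. by move=> p1 aw; apply: (filt_mode_neg _ _ _ (raise_lt k p1 aw)); lia. Qed.

(** With [m = p./2], the bracket [[L_m, L_{-m}]] is [2 m L_0] plus a scalar, which adds [2 m] to the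
    leading coefficient. *)
Lemma raise_lower_odd p w k j : (1 < p)%N -> letters w -> odd p ->
  filt (weight w)%:Z ((size w).*2 + k.+2)
    (lower p (raise p (act w (G0_pow k))) - j%:R *: act w (G0_pow k.+2)) ->
  filt (weight w)%:Z ((size w).*2 + k.+2)
    (raise p (act (p :: w) (G0_pow k)) - (j + (p./2).*2)%:R *: act w (G0_pow k.+2)).
Proof.
move=> p1 lw po Fj; rewrite po in Fj *.
rewrite /= po mode_comm subrr addrAC; apply: filtD; last first.
  by apply: filtZ; apply: filt_word => //; lia.
rewrite natrD scalerDl opprD addrACA; apply: filtD; first by rewrite scale1r.
have -> : (p./2).*2%:R = bcoef true true (p./2)%:Z (- (p./2)%:Z).
  by rewrite /bcoef opprK -addnn -PoszD.
by rewrite -scalerBr; apply: filtZ; apply: L0_lead.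
Qed.

(** An even [p] occurs once and [[G_m, G_{-m}]] gives [j = 2]. For odd [p] each copy of [p] at the
    head contributes [2 m], with [m = p./2], and the smaller letters contribute nothing; no
    cancellation can occur. *)
Lemma raise_lead p w k : letters (p :: w) -> path adm p w ->
  exists2 j : nat, (0 < j)%N & filt (weight w)%:Z ((size w).*2 + k.+2)
    (raise p (act (p :: w) (G0_pow k)) - j%:R *: act w (G0_pow k.+2)).
Proof.
case/andP=> p1 lw pw; have p2 : (0 < p./2)%N by lia.
case po: (odd p); last first.
  exists 2%N => //; rewrite /= po mode_comm subrr addrAC; apply: filtD; last first.
    by apply: filtZ; apply: filt_word => //; lia.
  rewrite -addrA; apply: filtD.
    by apply: filtZ; rewrite -po; apply: lower_raise_lt => //; apply: adm_path_lt; rewrite ?po.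
  by rewrite -scalerBr; apply: filtZ; apply: L0_lead.
rewrite -po.
(* Lowering again after raising restores the word, so this form can be iterated over the remaining
   copies of [p]. *)
suff [j Fj] : exists j : nat, filt (weight w)%:Z ((size w).*2 + k.+2)
    (lower p (raise p (act w (G0_pow k))) - j%:R *: act w (G0_pow k.+2)).
  by exists (j + (p./2).*2)%N; [lia | apply: raise_lower_odd].
elim: w lw pw => [|n w IH] lw pw.
  by exists 0%N; rewrite scale0r subr0; apply: lower_raise_lt.
case/andP: (lw) => n1 lw'; case/andP: pw => pn pw.
have pw' : path adm n w by [].
have [np|np] := ltnP n p.
  exists 0%N; rewrite scale0r subr0; apply: lower_raise_lt => //=; rewrite n1 np /=.
  apply/allP => i iw; rewrite (allP lw') //=.
  move: pw'; rewrite (path_sortedE adm_trans) => /andP[/allP /(_ i iw)].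
  by rewrite /adm; case: (odd n); lia.
have En : n = p by move: pn; rewrite /adm po; lia.
rewrite {}En {n np n1 pn} in lw pw pw' *.
have [j Fj] := IH lw' pw'.
have Fj' := raise_lower_odd p1 lw' po Fj.
exists (j + (p./2).*2)%N.
have -> : act (p :: w) (G0_pow k.+2) = lower p (act w (G0_pow k.+2)) by [].
rewrite -(lin_opZ (lin_mode _ _)) -(lin_opB (lin_mode _ _)).
by apply: (filt_mode_neg _ _ _ Fj'); rewrite /weight /=; lia.
Qed.

Lemma weight_cons n w : weight (n :: w) = (n./2 + weight w)%N.
Proof. by []. Qed.

(** Diagonal of the triangular pairing: by [raise_lead], each removed letter is traded for [G_0^2]
    and a positive factor. *)
Lemma pact_act_eq w k : letters w -> sorted adm w ->
  exists2 j : nat, (0 < j)%N &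
    filt 0 ((size w).*2 + k) (pact w (act w (G0_pow k)) - j%:R *: G0_pow (k + (size w).*2)).
Proof.
elim: w k => [|p w IH] k /=.
  by exists 1%N => //; rewrite /= scale1r addn0 subrr; apply: filt_0.
move=> lpw pw; have [j1 j1p F1] := raise_lead k lpw pw.
have /andP[p1 lw] := lpw.
have [j2 j2p F2] := IH k.+2 lw (path_sorted pw).
exists (j1 * j2)%N; first by rewrite muln_gt0 j1p.
have := filt_pact lw (esym (subrr _)) F1.
rewrite (lin_opB (lin_pact _)) (lin_opZ (lin_pact _)) => F1'.
have := filtD F1' (filtZ j1%:R F2).
rewrite scalerBr scalerA -natrM addrA subrK => H.
have -> : (k + (size w).+1.*2 = k.+2 + (size w).*2)%N by lia.
by apply: filt_mon H; lia.
Qed.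

(** Off-diagonal part: equal heads are stripped by [raise_lead]; at the first difference the letters
    left in [u] are all smaller than the raising letter, and the degree drops by [raise_lt]. *)
Lemma pact_act_lt w u k : letters w -> letters u -> sorted adm w ->
  sorted adm u -> (u < w :> seqlexi nat)%O ->
  filt ((weight u)%:Z - (weight w)%:Z) ((size u).*2 + k) (pact w (act u (G0_pow k))).
Proof.
elim: w u k => [|p w IH] u k; first by rewrite ltxis0.
case: u => [|q u] lpw lqu pw qu.
  have /andP[p1 lw] := lpw.
  move=> _; rewrite /= mode_G0_pow ?(lin_op0 (lin_pact _)); [exact: filt_0 | lia].
have /andP[p1 lw] := lpw; have /andP[q1 lu] := lqu.
rewrite ltxi_cons !leEnat; case: (ltngtP q p) => //= [qp _|Eq uw].
  have aqu : all (fun n => 1 < n < p)%N (q :: u).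
    rewrite /= q1 qp /=; apply/allP => i iu; rewrite (allP lu) //=.
    have := qu; rewrite /= (path_sortedE adm_trans) => /andP[/allP /(_ i iu)].
    by rewrite /adm; case: (odd q); lia.
  by apply: (filt_pact lw _ (raise_lt k p1 aqu)); rewrite !weight_cons; lia.
rewrite {}Eq {q q1 lqu} in qu *.
have lpu : letters (p :: u) by rewrite /= p1.
have [j _ Fj] := raise_lead k lpu qu.
have Fj' : filt ((weight (p :: u))%:Z - (weight (p :: w))%:Z) ((size u).*2 + k.+2)
    (pact w (raise p (act (p :: u) (G0_pow k)) - j%:R *: act u (G0_pow k.+2))).
  by apply: filt_pact Fj => //; rewrite !weight_cons; lia.
have := IH u k.+2 lw lu (path_sorted pw) (path_sorted qu) uw.
have -> : (weight u)%:Z - (weight w)%:Z = (weight (p :: u))%:Z - (weight (p :: w))%:Z.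
  by rewrite !weight_cons; lia.
move=> /(filtZ j%:R) /(filtD Fj').
rewrite (lin_opB (lin_pact _)) (lin_opZ (lin_pact _)) subrK.
by apply: filt_mon; rewrite /=; lia.
Qed.

(** * Straightening into normal words *)

(** Insertion sort modulo lower degree: each exchange costs a sign and a bracket, which has one
    letter fewer. The first alternative arises from a repeated fermionic letter. *)
Lemma insert_letter n w k : (1 < n)%N -> letters w -> sorted adm w ->
  let d := ((size w).*2 + k.+2)%N in
  filt (weight (n :: w))%:Z d (act (n :: w) (G0_pow k)) \/
  exists (a : R[i]) u, [/\ perm_eq u (n :: w), sorted adm u &
    filt (weight (n :: w))%:Z d (act (n :: w) (G0_pow k) - a *: act u (G0_pow k))].
Proof.
move=> n1; elim: w => [|z w IH] lw sw d.
  by right; exists 1, [:: n]; split=> //; rewrite scale1r subrr; apply: filt_0.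
have /andP[z1 lw'] := lw; have sw' := path_sorted sw.
case nz: (adm n z).
  by right; exists 1, [:: n, z & w]; split; rewrite /= ?nz // scale1r subrr; apply: filt_0.
have low : filt (weight [:: n, z & w])%:Z d
    (bcoef (odd n) (odd z) (- (n./2)%:Z) (- (z./2)%:Z) *:
     mode (odd n == odd z) (- (n./2)%:Z + - (z./2)%:Z) (act w (G0_pow k))).
  apply: filtZ; have H : filt (weight w)%:Z ((size w).*2 + k.+1) (act w (G0_pow k)).
    by apply: filt_word => //; lia.
  rewrite -opprD; apply: (filt_mode_neg _ _ _ H); rewrite ?weight_cons /d /=; lia.
have b0 : bcentral (odd n) (odd z) (- (n./2)%:Z) (- (z./2)%:Z) = 0.
  by apply: bcentral_eq0; lia.
have E : act [:: n, z & w] (G0_pow k) = bsign (odd n) (odd z) *: lower z (act (n :: w) (G0_pow k))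
    + bcoef (odd n) (odd z) (- (n./2)%:Z) (- (z./2)%:Z) *:
     mode (odd n == odd z) (- (n./2)%:Z + - (z./2)%:Z) (act w (G0_pow k)).
  by rewrite /= mode_comm b0 scale0r addr0.
have [En|nez] := eqVneq n z.
  (* Exchanging two equal fermionic letters gives [X = - X + Y], so [X] is half of the bracket [Y],
     which has lower degree. *)
  left; have no : odd n = false.
    by move: nz; rewrite -En /adm; case: (odd n); rewrite ?leqnn.
  move: E low; rewrite -En /= no /bsign /= scaleN1r => E low.
  set X := (X in filt _ _ X); set Y := (Y in filt _ _ Y) in low.
  suff -> : X = 2%:R^-1 *: Y by apply: filtZ.
  have XE : X = - X + Y by rewrite {1}/X E.
  have -> : Y = 2%:R *: X by rewrite scaler_nat mulr2n -[LHS](addNKr X) -XE.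
  by rewrite scalerA mulVf ?scale1r // pnatr_eq0.
have zn : adm z n by move: nz nez; rewrite /adm; case: (odd n); case: (odd z); lia.
have up y : filt (weight (n :: w))%:Z ((size w).*2 + k.+2) y ->
    filt (weight [:: n, z & w])%:Z d (lower z y).
  by move=> H; apply: (filt_mode_neg _ _ _ H); rewrite ?weight_cons /d /=; lia.
have [H|[a [u [pu su H]]]] := IH lw' sw'.
  by left; rewrite E; apply: filtD => //; apply: filtZ; apply: up.
right; exists (bsign (odd n) (odd z) * a), (z :: u); split.
- rewrite (perm_trans (_ : perm_eq _ (z :: n :: w))) ?perm_cons //.
  by apply/permP => i /=; rewrite addnCA.
- rewrite /= (path_sortedE adm_trans) su andbT (perm_all _ pu) /= zn.
  by move: sw; rewrite /= (path_sortedE adm_trans) => /andP[].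
- rewrite E addrAC; apply: filtD => //; rewrite -scalerA -scalerBr; apply: filtZ.
  by have := up _ H; rewrite (lin_opB (lin_mode _ _)) (lin_opZ (lin_mode _ _)).
Qed.

Lemma perm_weight u w : perm_eq u w -> weight u = weight w.
Proof. by move=> h; apply: perm_sumn; apply: perm_map. Qed.

Definition normal (N : int) (D : nat) (w : seq nat) : bool :=
  [&& letters w, sorted adm w, (weight w)%:Z == N & ((size w).*2 <= D)%N].

(** The power of [G_0] pads every word to degree exactly [D]. *)
Definition term (D : nat) (p : R[i] * seq nat) : V :=
  p.1 *: act p.2 (G0_pow (D - (size p.2).*2)).

Definition normal_form (N : int) (D : nat) (x : V) : Prop :=
  exists2 s : seq (R[i] * seq nat), all (fun p => normal N D p.2) s &
    filt N D (x - \sum_(p <- s) term D p).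

Lemma normal_form_comb N D a x y :
  normal_form N D x -> normal_form N D y -> normal_form N D (a *: x + y).
Proof.
move=> [s ns Fs] [t nt Ft]; exists ([seq (a * p.1, p.2) | p <- s] ++ t).
  by rewrite all_cat nt andbT all_map.
rewrite big_cat big_map opprD addrACA; apply: filtD => //.
under eq_bigr do rewrite /term -scalerA.
by rewrite -scaler_sumr -scalerBr; apply: filtZ.
Qed.

Lemma normal_form_low N D x : filt N D x -> normal_form N D x.
Proof. by exists [::] => //; rewrite big_nil subr0. Qed.

Lemma filt_normal_form N D x : filt N D.+1 x -> normal_form N D x.
Proof.
move E: D.+1 => D' H; elim: H D E => {N D' x}
  [N d|N d a x y _ IHx _ IHy|d p h|N M d e n x n1 -> le H IH] D E.
- by apply: normal_form_low; apply: filt_0.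
- by apply: normal_form_comb; auto.
(* Only the coefficient of ['X^D] has top degree; it goes with the empty word. *)
- exists [:: (p`_D, [::])]; first by [].
  rewrite big_seq1 /term /= subn0 -(peval_Xn D) addrC -scaleNr -pevalD.
  apply: filt_base; apply/leq_sizeP => i; rewrite leq_eqVlt coefD coefZ coefXn.
  case/orP => [/eqP <-|h']; first by rewrite eqxx mulr1 addNr.
  rewrite gt_eqF // mulr0 add0r nth_default // (leq_trans h) //.
  by rewrite -E.
- have [lt|ge] := ltnP d.+2 e.
    by apply: normal_form_low; apply: (filt_step n1 _ _ H) => //; lia.
  have Ed : e = d.+2 by lia.
  case: d {le ge} Ed H IH => [|d] Ed H IH.
    rewrite (filt_deg0 H) (lin_op0 (lin_mode _ _)).
    by apply: normal_form_low; apply: filt_0.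
  have [s ns Fs] := IH d erefl.
  have ED : D = d.+2 by lia.
  subst e D.
  rewrite -[x](subrK (\sum_(p <- s) term d p)) (lin_opD (lin_mode _ _)).
  rewrite -[lower n (x - _)]scale1r; apply: normal_form_comb.
    by apply: normal_form_low; apply: (filt_step n1 _ _ Fs).
  rewrite (lin_op_sum (lin_mode _ _)) big_seq.
  apply: big_ind => [|y z|[a w] /= ws].
  + by apply: normal_form_low; apply: filt_0.
  + by move=> hy hz; rewrite -[y]scale1r; apply: normal_form_comb.
  have /and4P[/= lw sw /eqP <- dw] := allP ns _ ws.
  rewrite /term /= (lin_opZ (lin_mode _ _)) -[_ *: _]addr0.
  apply: normal_form_comb; last by apply: normal_form_low; apply: filt_0.
  set k := (d - _)%N; have Ek : d.+2 = ((size w).*2 + k.+2)%N by rewrite 2!addnS subnKC.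
  have := insert_letter k n1 lw sw; rewrite -Ek weight_cons.
  have -> : (weight w)%:Z + (n./2)%:Z = (n./2 + weight w)%N%:Z by lia.
  case=> [H'|[b [u [pu su H']]]]; first exact: normal_form_low.
  exists [:: (b, u)].
    rewrite /= andbT /normal su (perm_weight pu) weight_cons eqxx (perm_size pu) /=.
    by rewrite /letters (perm_all _ pu) /= n1 -/(letters w) lw doubleS !ltnS.
  rewrite big_seq1 /term /= (perm_size pu) /=.
  by rewrite doubleS !subSS.
Qed.

(** * Independence of the weight spaces in the torsion free case *)

Hypothesis tfree : forall p : {poly R[i]}, peval p = 0 -> p = 0.

Lemma max_word (s : seq (seq nat)) : s != [::] ->
  exists2 w, w \in s & forall u, u \in s -> u != w -> (u < w :> seqlexi nat)%O.
Proof.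
elim: s => // w [|w' s] IH _.
  by exists w; rewrite ?mem_head // => u; rewrite inE => ->.
have [//|m ms mM] := IH.
case: (ltgtP (w : seqlexi nat) (m : seqlexi nat)) => [h|h|E].
- exists m; first by rewrite inE ms orbT.
  by move=> u; rewrite inE => /orP[/eqP ->|/mM //].
- exists w; first exact: mem_head.
  move=> u; rewrite inE => /orP[->//|us _].
  by have [->//|um] := eqVneq u m; apply: lt_trans h; apply: mM.
- exists m => // [|u]; first by rewrite inE ms orbT.
  by rewrite inE E => /orP[->//|/mM].
Qed.

(* Among the normal words of top degree in [x], the lexicographically largest
   one is detected by the raising operators, hence has coefficient 0. *)
Lemma lower_degree N D x s :
  (forall w, letters w -> (weight w)%:Z = N -> pact w x = 0) ->
  all (fun p => normal N D p.2) s ->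
  filt N D (x - \sum_(p <- s) term D p) -> filt N D x.
Proof.
move=> ann; have [n] := ubnP (size s); elim: n s => // n IH s sn ns Fs.
have [s0|s0] := eqVneq s [::]; first by move: Fs; rewrite s0 big_nil subr0.
have [|w ws wM] := @max_word [seq p.2 | p <- s]; first by case: (s) s0.
have norm_w : normal N D w by move: ws => /mapP[p ps ->]; apply: (allP ns).
have /and4P[lw sw /eqP wN wD] := norm_w.
pose A := \sum_(p <- s | p.2 == w) p.1.
set B := act w (G0_pow (D - (size w).*2)).
have sumE : \sum_(p <- s) term D p =
    A *: B + \sum_(p <- [seq p <- s | p.2 != w]) term D p.
  rewrite (bigID (fun p => p.2 == w)) /= big_filter scaler_suml.
  by congr (_ + _); apply: eq_bigr => p /eqP pw; rewrite /term pw.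
have w0 : N - (weight w)%:Z = 0 by rewrite wN subrr.
have Fother p : p \in [seq p <- s | p.2 != w] -> filt 0 D (pact w (term D p)).
  rewrite mem_filter => /andP[pw ps].
  have /and4P[lp sp /eqP pN pD] := allP ns p ps.
  have lt := wM p.2 (map_f _ ps) pw.
  have := pact_act_lt (D - (size p.2).*2) lw lp sw sp lt.
  rewrite pN w0 subnKC // => H.
  by rewrite /term (lin_opZ (lin_pact _)); apply: filtZ.
have FA : filt 0 D (A *: pact w B).
  have := filt_pact lw (esym w0) Fs.
  rewrite sumE (lin_opB (lin_pact _)) ann // sub0r (lin_opD (lin_pact _)).
  rewrite (lin_opZ (lin_pact _)) (lin_op_sum (lin_pact _)) => H.
  have := filtB (filtZ (-1) H) (filt_sum Fother).
  by rewrite scaleN1r opprK addrK.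
have [j j0 Fj] := pact_act_eq (D - (size w).*2) lw sw.
rewrite subnKC // subnK // -/B in Fj.
(* Now [A * j] times [G_0^D v] equals [peval p] with [p] of degree below [D], so torsion freeness
   forces [A = 0]. *)
have := filtB FA (filtZ A Fj); rewrite -scalerBr subKr => /filt_wt0 /(_ erefl) [p pD pE].
have A0 : A = 0.
  have := @tfree (-1 *: p + (A * j%:R *: 'X^D + 0)).
  rewrite !pevalD peval0 addr0 peval_Xn -pE scaleN1r scalerA addNr.
  move=> /(_ erefl) /(congr1 (fun q : {poly R[i]} => q`_D)).
  rewrite addr0 coefD !coefZ coefXn eqxx mulr1 coef0 nth_default // mulr0 add0r.
  by move/eqP; rewrite mulf_eq0 pnatr_eq0 (gtn_eqF j0) orbF => /eqP.
apply: (IH [seq p <- s | p.2 != w]).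
- have h : (0 < count (fun p => p.2 == w) s)%N.
    by rewrite -has_count; move: ws => /mapP[q qs ->]; apply/hasP; exists q.
  move: sn; rewrite size_filter -(count_predC (fun p => p.2 == w)).
  by rewrite ltnS; apply: leq_trans; rewrite -[ltnLHS]add0n ltn_add2r.
- by apply/allP => q; rewrite mem_filter => /andP[_]; apply: (allP ns).
- by move: Fs; rewrite sumE A0 scale0r add0r.
Qed.

Lemma ann_eq0 N D x : filt N D x ->
  (forall w, letters w -> (weight w)%:Z = N -> pact w x = 0) -> x = 0.
Proof.
elim: D x => [|D IH] x Fx ann; first exact: (filt_deg0 Fx).
have [s ns Fs] := filt_normal_form Fx.
by apply: IH => //; apply: lower_degree ns Fs.
Qed.

(** Raising words whose weight is the top one send all other components to negative weight, hence to
    0, so [ann_eq0] kills the top component. *)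
Lemma filt_direct n D (f : nat -> V) : (forall N, filt N%:Z D (f N)) ->
  \sum_(N < n) f N = 0 -> forall N, (N < n)%N -> f N = 0.
Proof.
move=> Ff; elim: n => // n IH; rewrite big_ord_recr /= => s0.
have fn : f n = 0.
  apply: (ann_eq0 (Ff n)) => w lw wn.
  have := congr1 (pact w) s0; rewrite (lin_opD (lin_pact _)) (lin_op0 (lin_pact _)).
  rewrite (lin_op_sum (lin_pact _)) big1 ?add0r // => i _.
  by apply: (filt_lt0 (filt_pact lw erefl (Ff i))); have := ltn_ord i; lia.
move: s0; rewrite fn addr0 => s0 N; rewrite ltnS leq_eqVlt => /orP[/eqP ->//|].
exact: IH.
Qed.

Lemma sum_trunc n m (f : nat -> V) : (n <= m)%N ->
  (forall N, (n <= N)%N -> f N = 0) -> \sum_(N < m) f N = \sum_(N < n) f N.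
Proof.
move=> nm f0; rewrite (big_ord_widen m f nm) [RHS]big_mkcond.
by apply: eq_bigr => N _; case: ltnP => // /f0.
Qed.

Definition graded_sum (x : V) : Prop := exists n D (f : nat -> V),
  [/\ forall N, filt N%:Z D (f N), forall N, (n <= N)%N -> f N = 0
    & x = \sum_(N < n) f N].

Lemma graded_sum_subspace : subspace graded_sum.
Proof.
split; first by exists 0%N, 0%N, (fun=> 0); split=> // [N|]; [apply: filt_0 | rewrite big_ord0].
move=> a x y [n [D [f [Ff f0 ->]]]] [m [E [h [Fh h0 ->]]]].
exists (maxn n m), (maxn D E), (fun N => a *: f N + h N); split=> [N|N|].
- by apply: filt_comb; [apply: filt_mon (Ff N) | apply: filt_mon (Fh N)];
    rewrite ?leq_maxl ?leq_maxr.
- by rewrite geq_max => /andP[nN mN]; rewrite f0 // h0 // scaler0 addr0.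
- rewrite -(sum_trunc (leq_maxl n m) f0) -(sum_trunc (leq_maxr n m) h0).
  by rewrite scaler_sumr -big_split.
Qed.

Lemma filt_graded_sum N D x : filt N D x -> graded_sum x.
Proof.
case: N => N Fx; last by rewrite (filt_lt0 Fx) //; case: graded_sum_subspace.
exists N.+1, D, (fun M => if M == N then x else 0); split=> [M|M NM|].
- by case: eqP => [->//|_]; apply: filt_0.
- by rewrite gtn_eqF.
- by rewrite (bigD1 ord_max) //= eqxx big1 ?addr0 // => i /negPf; rewrite -val_eqE /= => ->.
Qed.

Lemma graded_sum_mode t m x : graded_sum x -> graded_sum (mode t m x).
Proof.
have [s0 sD] := graded_sum_subspace.
move=> [n [D [f [Ff _ ->]]]]; rewrite (lin_op_sum (lin_mode _ _)).
apply: big_ind => // [y z hy hz|i _]; first by rewrite -[y]scale1r; apply: sD.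
exact: filt_graded_sum (filt_mode erefl (Ff i)).
Qed.

End Filtration.

(** * Comparison of the weight spaces built on [v] and on [G_0 v] *)

Section TorsionFree.
Context (R : realType) (V : lmodType R[i]) (L G : int -> V -> V) (l : R[i]).
Hypothesis linL : forall m, lin_op (L m).
Hypothesis linG : forall m, lin_op (G m).
Hypothesis LL : forall m n v, L m (L n v) - L n (L m v) =
  (m - n)%:~R *: L (m + n) v
  + kdelta m n (((m ^+ 3 - m)%:~R) / 12%:R) *: (l *: v).
Hypothesis LG : forall m n v, L m (G n v) - G n (L m v) =
  ((m%:~R) / 2%:R - n%:~R) *: G (m + n) v.
Hypothesis GG : forall m n v, G m (G n v) + G n (G m v) =
  2%:R *: L (m + n) v
  + kdelta m n (3%:R^-1 * ((m ^+ 2)%:~R - 4%:R^-1)) *: (l *: v).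

Lemma peval_shift (v : V) p : peval G (G 0 v) p = peval G v (p * 'X).
Proof. by rewrite pevalMX // /peval (poly_op_comm (linG 0)). Qed.

Lemma filt_shift (v : V) N d x : filt L G (G 0 v) N d x -> filt L G v N d.+1 x.
Proof.
elim=> {N d x} [N d|N d a x y _ IHx _ IHy|d p h|N M d e n x n1 EM le _ IH].
- exact: filt_0.
- exact: filt_comb.
- rewrite peval_shift; apply: filt_base; rewrite -[d.+1]addn1.
  have [->|p0] := eqVneq p 0; first by rewrite mul0r size_poly0.
  by rewrite size_mulX // addn1.
- exact: filt_step IH.
Qed.

Lemma torsion_free_not_generated (v : V) : Rplus_ann L G v ->
  (forall p : {poly R[i]}, peval G v p = 0 -> p = 0) ->
  ~ graded_sum L G (G 0 v) v.
Proof.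
move=> sv tf [n [D [f [Ff f0 vE]]]].
have n0 : (0 < n)%N.
  rewrite lt0n; apply/eqP => n0; have v0 : v = 0 by rewrite vE n0 big_ord0.
  have := tf 'X^0; rewrite (peval_Xn linG) => /(_ v0) /eqP.
  by rewrite expr0 oner_eq0.
have [p pD pE] := filt_wt0 linL linG (Ff 0%N) erefl.
rewrite peval_shift in pE.
(* Moving [v] into the weight 0 component turns the expansion of [v] into a vanishing sum. *)
pose h N := if N == 0%N then f 0%N - v else f N.
have Fh N : filt L G v N%:Z D.+1 (h N).
  case: N => [|N]; last exact: filt_shift (Ff N.+1).
  apply: filtB; first exact: filt_shift (Ff 0%N).
  have : filt L G v 0 D.+1 (peval G v 'X^0) by apply: filt_base; rewrite size_polyXn.
  by rewrite (peval_Xn linG).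
have sum_h : \sum_(N < n) h N = 0.
  case: (n) n0 vE => // m _ vE.
  by rewrite big_ord_recl /h /= addrAC -(big_ord_recl m f) -vE subrr.
have := filt_direct linL linG LL LG GG sv tf Fh sum_h n0.
rewrite /h /= pE => E.
(* This polynomial has constant coefficient -1, so it cannot be 0. *)
have /tf : peval G v (-1 *: 'X^0 + p * 'X) = 0.
  by rewrite pevalD (peval_Xn linG) scaleN1r addrC.
move=> /(congr1 (fun q : {poly R[i]} => q`_0)) /eqP.
by rewrite coefD coefZ coefXn coefMX coef0 mulr1 addr0 oppr_eq0 oner_eq0.
Qed.

End TorsionFree.

(** * Uncountability of the reals *)

Section Uncountable.
Context (R : realType).
Implicit Types (a b x : R) (s : seq R).

Lemma subitv_avoid s a b : a < b -> exists a' b',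
  [/\ a <= a', a' < b', b' <= b & forall x, a' <= x <= b' -> x \notin s].
Proof.
elim: s a b => [|y s IH] a b ab; first by exists a, b; split.
have [a1 [b1 [aa1 ab1 bb1 ny]]] : exists a1 b1,
    [/\ a <= a1, a1 < b1, b1 <= b & forall x, a1 <= x <= b1 -> x != y].
  (* Keep the right half if [y] lies left of the midpoint, and the left quarter otherwise. *)
  have [my|ym] := ltP y ((a + b) / 2%:R).
    by exists ((a + b) / 2%:R), b; split; [lra | lra | lra | move=> x xab; apply/eqP; lra].
  by exists a, ((3%:R * a + b) / 4%:R); split; [lra | lra | lra | move=> x xab; apply/eqP; lra].
have [a2 [b2 [a12 ab2 b12 ns]]] := IH a1 b1 ab1.
exists a2, b2; split=> //; [exact: le_trans a12 | exact: le_trans bb1 |].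
move=> x /andP[ax xb]; rewrite inE negb_or ns ?ax // andbT ny //.
by rewrite (le_trans a12) // (le_trans xb).
Qed.

(** Cantor's nested intervals: stage [n] avoids the finite list [s n], and the supremum of the left
    endpoints lies in all of them. *)
Lemma real_uncountable (s : nat -> seq R) : exists x, forall n, x \notin s n.
Proof.
have step n (p : {p : R * R | p.1 < p.2}) : {q : {p : R * R | p.1 < p.2} |
    (sval p).1 <= (sval q).1 /\ (sval q).2 <= (sval p).2 /\
    forall x, (sval q).1 <= x <= (sval q).2 -> x \notin s n}.
  case: p => -[a b] /= ab; apply: cid.
  have [a' [b' [h1 h2 h3 h4]]] := subitv_avoid (s n) ab.
  by exists (exist _ (a', b') h2).
pose I := fix I n : {p : R * R | p.1 < p.2} :=
  if n is m.+1 then sval (step m (I m)) else exist _ (0, 1) ltr01.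
pose lo n := (sval (I n)).1; pose hi n := (sval (I n)).2.
have lohi n : lo n < hi n by rewrite /lo /hi; case: (I n).
have Iprop n := svalP (step n (I n)).
have lo_mon n k : lo n <= lo (n + k)%N.
  elim: k => [|k IH]; rewrite ?addn0 // addnS (le_trans IH) //.
  by case: (Iprop (n + k)%N).
have hi_mon n k : hi (n + k)%N <= hi n.
  elim: k => [|k IH]; rewrite ?addn0 // addnS; apply: le_trans IH.
  by case: (Iprop (n + k)%N) => _ [].
have lo_hi n m : lo n <= hi m.
  rewrite (le_trans (lo_mon n m)) // (le_trans (ltW (lohi _))) //.
  by rewrite addnC hi_mon.
pose S := fun y => exists n, y = lo n.
have S_sup : has_sup S.
  by split; [exists (lo 0%N), 0%N | exists (hi 0%N) => _ [n ->]; apply: lo_hi].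
exists (sup S) => n; case: (Iprop n) => _ [_]; apply; apply/andP; split.
  by apply: sup_upper_bound => //; exists n.+1.
by apply: ge_sup => [|_ [m ->]]; [exists (lo 0%N), 0%N | exact: (lo_hi m n.+1)].
Qed.

End Uncountable.

(** A duplicate-free list of maximal length in [P] cannot be extended, hence exhausts [P]. *)
Lemma size_bounded_cover (T : eqType) (P : T -> Prop) n :
  (forall s : seq T, uniq s -> (forall x, x \in s -> P x) -> (size s <= n)%N) ->
  exists s : seq T, forall x, P x -> x \in s.
Proof.
elim: n => [|n IH] H.
  by exists [::] => x Px; have := H [:: x] erefl; apply=> y; rewrite inE => /eqP ->.
have [[s [us Ps sn]]|no] := pselect (exists s : seq T,
    [/\ uniq s, forall x, x \in s -> P x & size s = n.+1]).
  exists s => x Px; apply: contraT => xs.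
  have := H (x :: s); rewrite /= xs us sn ltnn; apply=> // y.
  by rewrite inE => /orP[/eqP ->//|/Ps].
apply: IH => s us Ps; have := H s us Ps; rewrite leq_eqVlt ltnS => /orP[/eqP sn|//].
by case: no; exists s.
Qed.

(** * Eigenvectors in countable dimension *)

Section Schur.
Context (R : realType) (V : lmodType R[i]).

Definition spanned (e : nat -> V) (n : nat) (x : V) : Prop :=
  exists a : nat -> R[i], x = \sum_(i < n) a i *: e i.

Lemma spanned_mon e n m x : (n <= m)%N -> spanned e n x -> spanned e m x.
Proof.
move=> nm [a ->]; exists (fun i => if (i < n)%N then a i else 0).
rewrite (big_ord_widen m (fun i => a i *: e i) nm) big_mkcond.
by apply: eq_bigr => i _; case: ifP => // _; rewrite scale0r.
Qed.

Lemma spanned_comb e n a x y :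
  spanned e n x -> spanned e n y -> spanned e n (a *: x + y).
Proof.
move=> [b ->] [d ->]; exists (fun i => a * b i + d i).
rewrite scaler_sumr -big_split; apply: eq_bigr => i _ /=.
by rewrite scalerDl scalerA.
Qed.

Lemma spanned_subspace e : subspace (fun x => exists n, spanned e n x).
Proof.
split; first by exists 0%N, (fun=> 0); rewrite big_ord0.
move=> a x y [n xn] [m ym]; exists (maxn n m).
by apply: spanned_comb; [apply: spanned_mon xn | apply: spanned_mon ym];
  rewrite ?leq_maxl ?leq_maxr.
Qed.

(** The coordinate matrix has more rows than columns, so its left kernel has a nonzero row. *)
Lemma spanned_dep e n m (u : 'I_m -> V) : (n < m)%N ->
  (forall i, spanned e n (u i)) ->
  exists2 b : 'I_m -> R[i], (exists i, b i != 0) & \sum_i b i *: u i = 0.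
Proof.
move=> nm /choice[a uE]; pose M : 'M[R[i]]_(m, n) := \matrix_(i, j) a i j.
have kM : kermx M != 0.
  rewrite -mxrank_eq0 mxrank_ker subn_eq0 -ltnNge.
  exact: leq_ltn_trans (rank_leq_col M) nm.
pose b := nz_row (kermx M).
have b0 : b != 0 by rewrite nz_row_eq0.
exists (fun i => b 0 i).
  by have /rV0Pn[i bi] := b0; exists i.
have bM : b *m M = 0 by apply/sub_kermxP; apply: nz_row_sub.
under eq_bigr do rewrite uE scaler_sumr.
rewrite exchange_big big1 // => j _; under eq_bigr do rewrite scalerA.
rewrite -scaler_suml; have := congr1 (fun N : 'rV_n => N 0 j) bM.
rewrite !mxE => E; rewrite [X in X *: _](_ : _ = 0) ?scale0r // -[RHS]E.
by apply: eq_bigr => i _; rewrite mxE.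
Qed.

(* The vectors [(f - a)^-1 v] are linearly independent unless [f] is killed on
   [v] by a polynomial. *)
Lemma resolvent_indep (f : V -> V) (v : V) m (a : 'I_m -> R[i]) (u : 'I_m -> V)
    (b : 'I_m -> R[i]) : lin_op f -> v != 0 -> injective a ->
  (forall i, f (u i) - a i *: u i = v) -> \sum_i b i *: u i = 0 ->
  (exists i, b i != 0) -> exists r x, x != 0 /\ f x = r *: x.
Proof.
move=> fl v0 ainj uE s0 [k bk].
(* Applying all the [f - a j] clears denominators: the relation among the [u i] becomes a polynomial
   in [f] killing [v]. *)
pose q i := \prod_(j | j != i) ('X - (a j)%:P).
have qu i : poly_op f (\prod_j ('X - (a j)%:P)) (u i) = poly_op f (q i) v.
  rewrite (bigD1 i) //= mulrC -/(q i) poly_opMXsubC // -(uE i).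
  by rewrite (lin_opB (lin_poly_op fl _)) (lin_opZ (lin_poly_op fl _)) poly_op_comm.
have Q0 : poly_op f (\sum_i b i *: q i) v = 0.
  rewrite poly_op_sum; under eq_bigr do rewrite -qu -(lin_opZ (lin_poly_op fl _)).
  by rewrite -(lin_op_sum (lin_poly_op fl _)) s0 (lin_op0 (lin_poly_op fl _)).
(* At [a k] all summands but the [k]-th vanish, and that one does not as [a] is injective. *)
have Qk : \sum_i b i *: q i != 0.
  apply: contra_neq bk => /(congr1 (horner^~ (a k))).
  rewrite horner_sum (bigD1 k) //= big1 ?addr0 => [|i ik].
    rewrite hornerZ horner0 => /eqP; rewrite mulf_eq0 => /orP[/eqP //|].
    rewrite horner_prod => /prodf_eq0 [j jk].
    by rewrite hornerXsubC subr_eq0 => /eqP /ainj jE; rewrite jE eqxx in jk.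
  rewrite hornerZ horner_prod (bigD1 k) 1?eq_sym //= hornerXsubC subrr.
  by rewrite mul0r mulr0.
have [p [r [x0 xr]]] := poly_op_eigenvector fl Qk v0 Q0.
by exists r, (poly_op f p v).
Qed.

(** Without eigenvectors the resolvent vectors are independent, so at most [n] real [a] have theirs
    in the span of the first [n] vectors of [e]. Countably many finite sets would then cover the
    reals. *)
Lemma countable_dim_eigenvalue (e : nat -> V) (f : V -> V) (v : V) :
  lin_op f -> v != 0 -> (forall x, exists n, spanned e n x) ->
  (forall a, exists x, f x - a *: x = v) ->
  exists r x, x != 0 /\ f x = r *: x.
Proof.
move=> fl v0 esp /choice[u uE].
apply: contrapT => noeig.
have cover n : exists t : seq R, forall x, spanned e n (u x%:C%C) -> x \in t.
  apply: (@size_bounded_cover _ _ n) => t ut tP.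
  rewrite leqNgt; apply/negP => nt.
  pose a (i : 'I_(size t)) := (nth 0 t i)%:C%C.
  have Ha i : spanned e n (u (a i)) by apply: tP; rewrite mem_nth.
  have [b bn0 s0] := spanned_dep nt Ha.
  apply: noeig; apply: (resolvent_indep fl v0 _ (fun i => uE (a i)) s0 bn0).
  by move=> i j [] /eqP; rewrite nth_uniq // => /eqP /val_inj.
have [s sP] := choice cover.
have [x xs] := real_uncountable s.
have [n /sP] := esp (u x%:C%C).
exact/negP.
Qed.

End Schur.

(** * Consequences of graded simplicity *)

Section SimpleModule.
Context (R : realType) (V : lmodType R[i]) (V0 V1 : V -> Prop)
  (L G : int -> V -> V) (c : V -> V).
Hypothesis hmod : ramond_module V0 V1 L G c.
Hypothesis hsimple : simple_module V0 V1 L G c.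

Lemma subspaceZ (W : V -> Prop) a u : subspace W -> W u -> W (a *: u).
Proof. by move=> [W0 Wc] Wu; rewrite -[_ *: _]addr0; apply: Wc. Qed.

Lemma subspaceD (W : V -> Prop) u v : subspace W -> W u -> W v -> W (u + v).
Proof. by move=> [W0 Wc] Wu Wv; rewrite -[u]scale1r; apply: Wc. Qed.

Lemma subspace_sum (W : V -> Prop) (I : Type) (s : seq I) (E : I -> V) :
  subspace W -> (forall i, W (E i)) -> W (\sum_(i <- s) E i).
Proof.
by move=> sW WE; apply: big_ind => //; [case: sW | move=> *; apply: subspaceD].
Qed.

Lemma grading_add_eq0 a b : V0 a -> V1 b -> a + b = 0 -> a = 0 /\ b = 0.
Proof.
have [[s0 s1 dj _] _] := hmod => a0 b1 ab.
have E : a = - b by apply/eqP; rewrite -addr_eq0 ab.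
have a00 : a = 0.
  by apply: dj => //; rewrite E -scaleN1r; apply: subspaceZ.
by split=> //; rewrite -[b]opprK -E a00 oppr0.
Qed.

(** Simplicity concerns graded submodules only, so it is applied to the largest graded part [W'] of
    [W], which contains [w] by homogeneity. *)
Lemma homogeneous_generates w : V0 w \/ V1 w -> w != 0 -> generated_by L G c w.
Proof.
have [[s0 s1 dj dec] [_ [Lev [God [cev _]]]]] := hmod => hw w0 W sW [WL [WG Wc]] Ww.
pose W' x := exists x0 x1, [/\ W x0, V0 x0, W x1, V1 x1 & x = x0 + x1].
have [z0 z1 zW] : [/\ V0 0, V1 0 & W 0] by split; [case: s0 | case: s1 | case: sW].
have [linL [linG linc]] : (forall m, lin_op (L m)) /\ (forall m, lin_op (G m)) /\ lin_op c.
  by case: hmod => _ [].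
have gW' : graded_submodule V0 V1 L G c W'.
  split.
  - split; first by exists 0, 0; split; rewrite ?addr0.
    move=> a x y [x0 [x1 [? ? ? ? ->]]] [y0 [y1 [? ? ? ? ->]]].
    exists (a *: x0 + y0), (a *: x1 + y1).
    split; [exact: sW.2 | exact: s0.2 | exact: sW.2 | exact: s1.2 |].
    by rewrite scalerDr addrACA.
  - split=> [m|]; last split=> [m|].
    + move=> _ [x0 [x1 [w0' h0 w1 h1 ->]]]; exists (L m x0), (L m x1).
      by split; [exact: WL | exact: (Lev m x0).1 | exact: WL | exact: (Lev m x1).2
                | exact: lin_opD].
    + move=> _ [x0 [x1 [w0' h0 w1 h1 ->]]]; exists (G m x1), (G m x0).
      split; [exact: WG | exact: (God m x1).2 | exact: WG | exact: (God m x0).1 |].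
      by rewrite addrC lin_opD.
    + move=> _ [x0 [x1 [w0' h0 w1 h1 ->]]]; exists (c x0), (c x1).
      by split; [exact: Wc | exact: (cev x0).1 | exact: Wc | exact: (cev x1).2
                | exact: lin_opD].
  - move=> x [x0 [x1 [W0 h0 W1 h1 ->]]]; exists x0, x1; split=> //.
      by exists x0, 0; rewrite addr0.
    by exists 0, x1; rewrite add0r.
have W'w : W' w.
  by case: hw => h; [exists w, 0 | exists 0, w]; split; rewrite ?addr0 ?add0r.
case: hsimple => _ /(_ _ gW') [/(_ _ W'w) e|all_W' v]; first by rewrite e eqxx in w0.
by have [x0 [x1 [? ? ? ? ->]]] := all_W' v; apply: subspaceD.
Qed.

Lemma singular_components a b : V0 a -> V1 b -> Rplus_ann L G (a + b) ->
  Rplus_ann L G a /\ Rplus_ann L G b.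
Proof.
have [_ [[linL [linG _]] [Lev [God _]]]] := hmod => a0 b1 ab.
have H m : 0 < m -> [/\ L m a = 0, G m a = 0, L m b = 0 & G m b = 0].
  move=> /ab []; rewrite (lin_opD (linL m)) (lin_opD (linG m)) => Lm.
  rewrite addrC => Gm.
  have [? ?] := grading_add_eq0 ((Lev m a).1 a0) ((Lev m b).2 b1) Lm.
  by have [? ?] := grading_add_eq0 ((God m b).2 b1) ((God m a).1 a0) Gm.
by split=> m /H [].
Qed.

Lemma homogeneous_component v : v != 0 -> exists w0 w1,
  [/\ V0 w0, V1 w1, v = w0 + w1 & w0 != 0 \/ w1 != 0].
Proof.
have [[_ _ _ dec] _] := hmod => v0; have [w0 [w1 [h0 h1 vE]]] := dec v.
exists w0, w1; split=> //; have [e|] := eqVneq w0 0; last by left.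
by right; move: v0; rewrite vE e add0r.
Qed.

(** The operator [c - a] is even and commutes with every mode, so its kernel and image inherit the
    structure. *)
Lemma central_graded (a : R[i]) :
  graded_submodule V0 V1 L G c (fun x => c x - a *: x = 0) /\
  graded_submodule V0 V1 L G c (fun y => exists x, y = c x - a *: x).
Proof.
have [[s0 s1 dj dec] [[linL [linG linc]] [Lev [God [cev [_ [_ [_ cen]]]]]]]] := hmod.
pose h x := c x - a *: x.
have hl : lin_op h.
  move=> b x y; rewrite /h linc scalerDr opprD addrACA scalerBr.
  by rewrite !scalerA [a * b]mulrC.
have h0 x : V0 x -> V0 (h x).
  move=> x0; rewrite /h -scaleNr addrC; apply: s0.2 => //; exact: (cev x).1.
have h1 x : V1 x -> V1 (h x).
  move=> x1; rewrite /h -scaleNr addrC; apply: s1.2 => //; exact: (cev x).2.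
have hL m x : L m (h x) = h (L m x).
  by rewrite /h (lin_opB (linL m)) (lin_opZ (linL m)) (cen m x).1.
have hG m x : G m (h x) = h (G m x).
  by rewrite /h (lin_opB (linG m)) (lin_opZ (linG m)) (cen m x).2.
have hc x : c (h x) = h (c x) by rewrite /h (lin_opB linc) (lin_opZ linc).
rewrite -/(h _); split; split.
- split; first exact: (lin_op0 hl).
  by move=> b x y; rewrite -!/(h _) hl => -> ->; rewrite scaler0 addr0.
- by split=> [m|]; last split=> [m|]; move=> x; rewrite -!/(h _) -?hL -?hG -?hc => ->;
    rewrite ?(lin_op0 (linL _)) ?(lin_op0 (linG _)) ?(lin_op0 linc).
- move=> w; rewrite -/(h w); have [w0 [w1 [? ? ->]]] := dec w.
  rewrite (lin_opD hl) => /grading_add_eq0 [||e0 e1]; [exact: h0 | exact: h1 |].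
  by exists w0, w1.
- split; first by exists 0; rewrite -/(h 0) (lin_op0 hl).
  move=> b _ _ [x ->] [y ->]; exists (b *: x + y).
  by rewrite -!/(h _) hl.
- split=> [m|]; last split=> [m|].
  + by move=> _ [x ->]; exists (L m x); apply: hL.
  + by move=> _ [x ->]; exists (G m x); apply: hG.
  + by move=> _ [x ->]; exists (c x); apply: hc.
- move=> _ [x ->]; have [x0 [x1 [? ? ->]]] := dec x.
  exists (h x0), (h x1); split; [by exists x0 | exact: h0 | by exists x1 | exact: h1 |].
  exact: (lin_opD hl).
Qed.

Lemma countably_spanned v : generated_by L G c v ->
  exists e : nat -> V, forall x, exists n, spanned e n x.
Proof.
have [_ [[linL [linG linc]] _]] := hmod => gen.
pose op (o : option (bool * int)) := if o is Some (t, m) then mode L G t m else c.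
have lin_op_op o : lin_op (op o) by case: o => [[[] m]|]; rewrite /op.
pose word (w : seq (option (bool * int))) := foldr op v w.
(* Words over a countable alphabet, with [None] for [c], are countable; a number coding no word gets
   the harmless value 0. *)
pose e n := if unpickle n is Some w then word w else 0.
exists e; pose W x := exists n, spanned e n x.
have sW : subspace W := spanned_subspace e.
have We w : W (word w).
  exists (pickle w).+1, (fun i => (i == pickle w)%:R).
  rewrite big_ord_recr /= eqxx scale1r /e pickleK big1 ?add0r // => i _.
  by rewrite ltn_eqF ?scale0r.
have Wop o x : W x -> W (op o x).
  move=> [n [a ->]]; rewrite (lin_op_sum (lin_op_op o)).
  apply: subspace_sum => // i; rewrite (lin_opZ (lin_op_op o)); apply: subspaceZ => //.
  rewrite /e; case: unpickle => [w|]; first exact: (We (o :: w)).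
  by rewrite (lin_op0 (lin_op_op o)); case: sW.
apply: (gen W) => //; last exact: (We [::]).
by split=> [m x|]; [exact: (Wop (Some (true, m))) |
  split=> [m x|x]; [exact: (Wop (Some (false, m))) | exact: (Wop None)]].
Qed.

(* Schur's lemma in countable dimension over an uncountable field. *)
Lemma central_scalar v : v != 0 -> generated_by L G c v ->
  exists l, forall x, c x = l *: x.
Proof.
have [_ [[_ [_ linc]] _]] := hmod => v0 gen.
have [e esp] := countably_spanned gen.
(* Either [c] gets an eigenvector and the kernel of [c - r] is everything, or some [c - a] misses
   [v] and its image is 0. *)
have [surj|nsurj] := pselect (forall a, exists x, c x - a *: x = v).
  have [r [x [x0 xr]]] := countable_dim_eigenvalue linc v0 esp surj.
  have [ker _] := central_graded r; exists r => y.
  case: hsimple => _ /(_ _ ker) [/(_ x)|/(_ y) /eqP]; last by rewrite subr_eq0 => /eqP.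
  by rewrite xr subrr => /(_ erefl) xe; rewrite xe eqxx in x0.
have [a na] := (existsNP _).2 nsurj; exists a => x.
have [_ im] := central_graded a.
case: hsimple => _ /(_ _ im) [im0|/(_ v) [y vE]]; last by case: na; exists y.
by apply/eqP; rewrite -subr_eq0; apply/eqP/im0; exists x.
Qed.

End SimpleModule.

Theorem theorem4p1 (R : realType) (V : lmodType R[i])
  (V0 V1 : V -> Prop) (L G : int -> V -> V) (c : V -> V) :
  ramond_module V0 V1 L G c ->
  simple_module V0 V1 L G c ->
  (exists v : V, v != 0 /\ Rplus_ann L G v) ->
  highest_weight_module L G c.
Proof.
move=> hmod hsimple [v' [v'0 sv']].
have [_ [[linL [linG linc]] [Lev [God [_ [LLc [LG [GGc _]]]]]]]] := hmod.
have [v [hv v0 sv]] : exists v, [/\ V0 v \/ V1 v, v != 0 & Rplus_ann L G v].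
  have [w0 [w1 [h0 h1 vE ne]]] := homogeneous_component hmod v'0.
  rewrite vE in sv'; have [s0 s1] := singular_components hmod h0 h1 sv'.
  by case: ne => ne; [exists w0 | exists w1]; split=> //; [left | right].
have [l cl] := central_scalar hmod hsimple v0 (homogeneous_generates hmod hsimple hv v0).
have LL m n x : L m (L n x) - L n (L m x) = (m - n)%:~R *: L (m + n) x
    + kdelta m n (((m ^+ 3 - m)%:~R) / 12%:R) *: (l *: x) by rewrite LLc cl.
have GG m n x : G m (G n x) + G n (G m x) = 2%:R *: L (m + n) x
    + kdelta m n (3%:R^-1 * ((m ^+ 2)%:~R - 4%:R^-1)) *: (l *: x) by rewrite GGc cl.
have [tf|ntf] := pselect (forall p : {poly R[i]}, peval G v p = 0 -> p = 0).
  exfalso; apply: (torsion_free_not_generated linL linG LL LG GG sv tf).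
  have hGv : V0 (G 0 v) \/ V1 (G 0 v).
    by case: hv => h; [right; apply: (God 0 v).1 | left; apply: (God 0 v).2].
  have Gv0 : G 0 v != 0.
    apply/eqP => e; have /tf/eqP : peval G v 'X^1 = 0 by rewrite (peval_Xn linG).
    by rewrite expr1 polyX_eq0.
  have sGv : Rplus_ann L G (G 0 v) := sing_G0_pow linG LG GG sv 1.
  have gm := graded_sum_mode linL linG LL LG GG sGv.
  have sub := graded_sum_subspace L G (G 0 v).
  (* The graded sum built on [G_0 v] is a submodule containing [G_0 v], which generates [V]; hence
     it contains [v]. *)
  apply: (homogeneous_generates hmod hsimple hGv Gv0 sub).
    split; first by move=> m x; apply: (gm true).
    split; first by move=> m x; apply: (gm false).
    by move=> x hx; rewrite cl; apply: subspaceZ.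
  apply: (filt_graded_sum linL linG (N := 0) (D := 1)).
  have : filt L G (G 0 v) 0 1 (peval G (G 0 v) 'X^0) by apply: filt_base; rewrite size_polyXn.
  by rewrite (peval_Xn linG).
have [p [px p0]] : exists p : {poly R[i]}, peval G v p = 0 /\ p != 0.
  have [p np] := (existsNP _).2 ntf; exists p.
  by have [? /eqP ?] := (not_implyP _ _).1 np.
have [q [r [y0 yr]]] := poly_op_eigenvector (linG 0) p0 v0 px.
set y := poly_op _ q v in y0 yr.
have sy : Rplus_ann L G y.
  have kill t m : 0 < m -> mode L G t m y = 0.
    move=> m0; rewrite /y /poly_op (lin_op_sum (lin_mode linL linG t m)) big1 // => i _.
    by rewrite (lin_opZ (lin_mode linL linG t m)) (mode_G0_pow linG LG GG sv) ?scaler0.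
  by move=> m m0; split; [apply: (kill true) | apply: (kill false)].
pose lam := r * r + l / 24%:R.
have yl : L 0 y = lam *: y.
  by rewrite (G0_sqr GG) yr (lin_opZ (linG 0)) yr scalerA scalerDl.
(* As [G_0] is odd, its eigenvector [y] need not be homogeneous; but [L_0 - lam] is even, so it
   kills both components of [y]. *)
have [w0 [w1 [h0 h1 yE ne]]] := homogeneous_component hmod y0.
rewrite yE in sy yl; have [s0 s1] := singular_components hmod h0 h1 sy.
have [e0 e1] : L 0 w0 - lam *: w0 = 0 /\ L 0 w1 - lam *: w1 = 0.
  have [[sub0 sub1 _ _] _] := hmod.
  apply: (grading_add_eq0 hmod).
  - by rewrite -scaleNr addrC; apply: sub0.2 => //; apply: (Lev 0 w0).1.
  - by rewrite -scaleNr addrC; apply: sub1.2 => //; apply: (Lev 0 w1).2.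
  - by rewrite addrACA -(lin_opD (linL 0)) yl -opprD -scalerDr subrr.
have hw (w : V) : V0 w \/ V1 w -> w != 0 -> Rplus_ann L G w ->
    L 0 w - lam *: w = 0 -> highest_weight_module L G c.
  move=> hw wn sw /eqP; rewrite subr_eq0 => /eqP we; exists w; split=> //.
    exact: (homogeneous_generates hmod hsimple).
  by exists lam, l.
by case: ne => ne; [apply: (hw w0) | apply: (hw w1)] => //; [left | right].
Qed.
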